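(* Let $r>0$ be a real number, let $k\ge 0$ be an integer, and let $X\subset Y$ be an inclusion of finite metric spaces such that $d_H(X^{k}_{dis},Y^{k}_{dis})<r$. Suppose that $(t,[x])$ is a layer point of $\Gamma_k(X)$ with $r<t<t_+-2r$, and suppose that $(s,[y])$ is the maximal layer point of $\Gamma_k(Y)$ below $(t,[i(x)])$. Then $t-2r\le s\le t$.
   Context: For a finite metric space $(X,d)$, an integer $k\ge 0$ and $s\in[0,\infty]$, the degree Rips complex $L_{s,k}(X)$ is the simplicial complex whose simplices are the non-empty subsets $\tau\subset X$ such that $d(x,x')\le s$ for all $x,x'\in\tau$ and each $x\in\tau$ has at least $k$ distinct neighbours $y\in X$ (with $y\neq x$) such that $d(x,y)\le s$. For $s\le t$ there is an inclusion $L_{s,k}(X)\subset L_{t,k}(X)$. For a vertex $x$ of $L_{s,k}(X)$, $[x]$ or $[x]_s$ denotes its path component, regarded both as an element of $\pi_0L_{s,k}(X)$ and as a subset of $X$ (the set of vertices in that component). The poset $\Gamma_k(X)$ has elements the pairs $(s,[x])$ with $s\in[0,\infty]$ and $[x]\in\pi_0L_{s,k}(X)$, with $(s,[x])\le(t,[y])$ if and only if $s\le t$ and $[x]=[y]$ in $\pi_0L_{t,k}(X)$ (equivalently $s\le t$ and $[x]_s\subset[y]_t$). A layer point of $\Gamma_k(X)$ is an element $(t,[x])$ such that either 1) whenever $(s,[y])\le(t,[x])$ with $s<t$, the set $[y]_s$ is a proper subset of $[x]_t$, or 2) there is no relation $(s,[y])\le(t,[x])$ with $s<t$. Every element of $\Gamma_k(X)$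 has a unique largest layer point below it, called the maximal layer point below it. The layer parameters of $X$ are the (finitely many) numbers $t$ such that $(t,[x])$ is a layer point of $\Gamma_k(X)$ for some $[x]$. For a layer parameter $t$ of $X$, $t_+$ is the smallest layer parameter of $X$ with $t<t_+$, with the convention $t_+=\infty$ if $t$ is the largest layer parameter. $X^k_{dis}$ denotes the set of $(k+1)$-tuples of distinct elements of $X$; for $X\subset Y$ the Hausdorff distance $d_H(X^k_{dis},Y^k_{dis})$ is computed in $Y^k_{dis}$ with the metric $d((y_i),(y_i'))=\max_i d(y_i,y'_i)$. The inclusion $X\subset Y$ is denoted $i$; it induces inclusions $L_{s,k}(X)\subset L_{s,k}(Y)$ and the poset morphism $\Gamma_k(X)\to\Gamma_k(Y)$, $(s,[x])\mapsto(s,[i(x)])$. *)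

(* Defs.v *)
From HB Require Import structures.
From mathcomp Require Import all_boot all_order all_algebra.
From mathcomp Require Import all_classical all_reals all_analysis.

Set Implicit Arguments.
Unset Strict Implicit.
Unset Printing Implicit Defensive.

Import Order.TTheory GRing.Theory Num.Theory.
Local Open Scope set_scope.
Local Open Scope ring_scope.

#[short(type="finMetricType")]
HB.structure Definition FinMetric (R : numDomainType) :=
  { M of Finite M & Metric R M }.

(* A simplicial complex on a finite type is given by its set of simplices;
   since its path components are determined by the 1-skeleton, [component]
   is defined through edge paths. *)
Section Components.
Variables (T : finType) (K : {set {set T}}).

Definition vertices : {set T} := [set x | [set x] \in K].

Definition edge : rel T := [rel x y | [set x; y] \in K].

Definition component (x : T) : {set T} :=
  [set y in vertices | connect edge x y].

Definition pi0 : {set {set T}} := [set component x | x in vertices].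

End Components.

Section HausdorffDistance.
Variables (R : realType) (T : finType) (d : T -> T -> R).

(* [0, +oo]-valued: 0 between two empty sets, +oo between an empty set and a
   nonempty one. *)
Definition hausdorff_dist (A B : {set T}) : \bar R :=
  Order.max
    (\big[Order.max/0%E]_(a in A) \big[Order.min/+oo%E]_(b in B) (d a b)%:E)
    (\big[Order.max/0%E]_(b in B) \big[Order.min/+oo%E]_(a in A) (d a b)%:E).

End HausdorffDistance.

(* A finite subset X of the ambient space Y is viewed as a metric space with the
   induced metric; Y itself is X = [set: Y]. *)
Section DegreeRips.
Variables (R : realType) (Y : finMetricType R) (k : nat) (X : {set Y}).

Definition distinct_tuples : {set k.+1.-tuple Y} :=
  [set u : k.+1.-tuple Y | uniq u & all (mem X) u].

Definition tuple_dist (u v : k.+1.-tuple Y) : R :=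
  \big[Num.max/0]_(i < k.+1) mdist (tnth u i) (tnth v i).

Definition neighbours (s : \bar R) (x : Y) : {set Y} :=
  [set y in X | (y != x) && ((mdist x y)%:E <= s)%E].

Definition degree_rips (s : \bar R) : {set {set Y}} :=
  [set tau : {set Y} | [&& tau != finset.set0, tau \subset X,
     [forall x in tau, forall x' in tau, ((mdist x x')%:E <= s)%E]
     & [forall x in tau, (k <= #|neighbours s x|)%N]]].

(* Elements of the poset Gamma_k(X): pairs (s, C) with s in [0, +oo] and
   C in pi_0 L_{s,k}(X), where a component is its set of vertices. *)
Definition in_gamma (p : \bar R * {set Y}) : bool :=
  (0 <= p.1)%E && (p.2 \in pi0 (degree_rips p.1)).

(* p.1 <= q.1, and the image of p.2 in pi_0 L_{q.1,k}(X) is q.2. *)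
Definition gamma_le (p q : \bar R * {set Y}) : Prop :=
  (p.1 <= q.1)%E /\
  exists2 x, x \in p.2 & component (degree_rips q.1) x = q.2.

Definition layer_point (p : \bar R * {set Y}) : Prop :=
  in_gamma p /\
  ((forall q, in_gamma q -> gamma_le q p -> (q.1 < p.1)%E ->
      q.2 \proper p.2)
   \/ ~ (exists q, [/\ in_gamma q, gamma_le q p & (q.1 < p.1)%E])).

Definition maximal_layer_point_below (p q : \bar R * {set Y}) : Prop :=
  [/\ layer_point p, gamma_le p q
    & forall p', layer_point p' -> gamma_le p' q -> gamma_le p' p].

Definition layer_param (t : \bar R) : Prop :=
  exists C : {set Y}, layer_point (t, C).

(* The smallest layer parameter > t, and +oo (infimum of the empty set) if there
   is none; see [next_layer_paramP]. *)
Definition next_layer_param (t : \bar R) : \bar R :=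
  ereal_inf [set u | layer_param u /\ (t < u)%E]%classic.

End DegreeRips.

Section Basics.
Variables (R : realType) (Y : finMetricType R) (k : nat) (X : {set Y}).
Implicit Types (s t : \bar R) (p q : \bar R * {set Y}).

Lemma in_vertices (T : finType) (K : {set {set T}}) x :
  (x \in vertices K) = ([set x]%SET \in K).
Proof. by rewrite inE. Qed.

Lemma in_componentE (T : finType) (K : {set {set T}}) x y :
  (y \in component K x) = (y \in vertices K) && connect (edge K) x y.
Proof. by rewrite finset.in_set. Qed.

Lemma edge_sym (T : finType) (K : {set {set T}}) : symmetric (edge K).
Proof. by move=> x y; rewrite /edge /= finset.setUC. Qed.

Lemma degree_ripsS s t : (s <= t)%E -> degree_rips k X s \subset degree_rips k X t.
Proof.
move=> st; apply/fintype.subsetP => tau; rewrite !inE => /and4P[-> -> /forall_inP h1 /forall_inP h2] /=.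
apply/andP; split.
  apply/forall_inP => x xt; apply/forall_inP => y yt.
  by apply: le_trans st; move/forall_inP: (h1 x xt) => /(_ y yt).
apply/forall_inP => x xt; apply: leq_trans (h2 x xt) _.
apply: subset_leq_card; apply/fintype.subsetP => y; rewrite !inE => /and3P[-> -> /=] h.
exact: le_trans st.
Qed.

Lemma in_component (T : finType) (K : {set {set T}}) (x y : T) :
  y \in component K x -> component K y = component K x.
Proof.
rewrite inE => /andP[_ xy]; apply/finset.setP => z; rewrite !inE.
by rewrite (same_connect (sym_connect_sym (@edge_sym T K)) xy).
Qed.

Lemma gamma_leP p q : in_gamma k X p -> in_gamma k X q ->
  gamma_le k X p q <-> (p.1 <= q.1)%E /\ p.2 \subset q.2.
Proof.
move=> /andP[_ /imsetP[x0 x0V Ep]] /andP[_ /imsetP[y0 y0V Eq]].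
split=> -[pq].
  move=> [x xp <-]; split=> //; apply/fintype.subsetP => y; rewrite Ep in xp *.
  rewrite -(in_component xp) !in_componentE => /andP[yV xy].
  have /fintype.subsetP sub := degree_ripsS pq.
  apply/andP; split; first by move: yV; rewrite !in_vertices; exact: sub.
  apply: connect_sub xy => a b ab.
  by apply: connect1; apply: sub.
move=> /fintype.subsetP sub; split=> //; exists x0; last first.
  rewrite Eq; apply: in_component; rewrite -Eq; apply: sub.
  by rewrite Ep in_componentE x0V connect0.
by rewrite Ep in_componentE x0V connect0.
Qed.

Lemma layer_param_dist t : layer_param k X t -> exists x y : Y, t = (mdist x y)%:E.
Proof.
move=> [C [/andP[/= t0 CP] lay]]; apply: contrapT => nt.
have /imsetP[x0 x0V EC] := CP.
have tD (a b : Y) : t != (mdist a b)%:E.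
  by apply/eqP => E; apply: nt; exists a, b.
have t_gt0 : (0 < t)%E.
  by rewrite lt_neqAle t0 andbT eq_sym; have := tD x0 x0; rewrite mdistxx.
pose s : \bar R := \big[Order.max/0%E]_(u : Y * Y | ((mdist u.1 u.2)%:E < t)%E)
  (mdist u.1 u.2)%:E.
have st : (s < t)%E.
  by apply: (big_ind (fun u : \bar R => (u < t)%E)) => // a b; rewrite gt_max => -> ->.
have s0 : (0 <= s)%E by exact: bigmax_ge_id.
have le_st (a b : Y) : ((mdist a b)%:E <= s)%E = ((mdist a b)%:E <= t)%E.
  apply/idP/idP => [|h]; first by move=> /le_trans; apply; apply: ltW.
  have h' : ((mdist a b)%:E < t)%E by rewrite lt_neqAle eq_sym tD.
  exact: (le_bigmax_cond 0%E (j := (a, b)) (fun u : Y * Y => (mdist u.1 u.2)%:E)%E).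
have Est : degree_rips k X s = degree_rips k X t.
  have En x : neighbours X s x = neighbours X t x.
    by apply/finset.setP => y; rewrite !inE le_st.
  apply/finset.setP => tau; rewrite !inE; congr [&& _, _, _ & _].
    by do 2 (apply: eq_forallb => ?; congr (_ ==> _)); rewrite le_st.
  by apply: eq_forallb => x; rewrite En.
have gs : in_gamma k X (s, C) by rewrite /in_gamma /= s0 Est.
have gle : gamma_le k X (s, C) (t, C).
  split=> /=; first exact: ltW.
  by exists x0; rewrite ?EC // in_componentE x0V connect0.
case: lay => [/(_ _ gs gle st)|]; first by rewrite fintype.properxx.
by case; exists (s, C).
Qed.

Lemma next_layer_paramP t (u := next_layer_param k X t) :
  ([/\ layer_param k X u, (t < u)%E
     & forall v, layer_param k X v -> (t < v)%E -> (u <= v)%E])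
  \/ (u = +oo%E /\ forall v, layer_param k X v -> ~ (t < v)%E).
Proof.
pose P (w : Y * Y) := `[< layer_param k X (mdist w.1 w.2)%:E /\
  (t < (mdist w.1 w.2)%:E)%E >].
have [[w0 Pw0]|none] := pselect (exists w, P w); last first.
  right; have none' v : layer_param k X v -> ~ (t < v)%E.
    move=> lv tv; apply: none; have [x [y E]] := layer_param_dist lv.
    by exists (x, y); apply/asboolP; rewrite /= -E.
  split=> //; rewrite /u /next_layer_param -[RHS]ereal_inf0; congr ereal_inf.
  by apply/seteqP; split=> // v [/none'].
left.
case: (@arg_minP _ _ _ w0 P (fun w => (mdist w.1 w.2)%:E) Pw0) => w /asboolP[lw tw] wmin.
have min v : layer_param k X v -> (t < v)%E -> ((mdist w.1 w.2)%:E <= v)%E.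
  move=> lv tv; have [x [y E]] := layer_param_dist lv.
  by rewrite E; apply: (wmin (x, y)); apply/asboolP; rewrite /= -E.
suff -> : u = (mdist w.1 w.2)%:E by [].
apply/eqP; rewrite eq_le; apply/andP; split; first exact: ereal_inf_lbound.
by apply: le_ereal_inf_tmp => v [lv tv]; exact: min.
Qed.

End Basics.

(* Main.v *)
Require Import Defs.
From mathcomp Require Import all_boot all_order all_algebra.
From mathcomp Require Import all_classical all_reals all_analysis.
From mathcomp Require Import lra.
Import Order.TTheory GRing.Theory Num.Theory.
Local Open Scope set_scope.
Local Open Scope ring_scope.

(** The inequality [s <= t] is part of [(s, [y]) <= (t, [i x])].  For the other
one, the maximal layer point below [q] has the same vertex set as [q]: going down
from [q] with the set held fixed, a last parameter is reached, because the degree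
Rips complex changes only at distances between points, and there one stands at a
layer point ([maximal_layer_point_set]).  Hence [[y]_s] and [[i x]_t] are one
subset of Y.

Suppose [s + 2r < t].  Every [z] in the component [[x]_t] of [L_t(X)] is then a
vertex of [L_s(Y)], connected there to [x].  Call [a] a shadow of [z] if it lies
at distance [< r] from [z] and is a vertex of [L_{s+2r}(X)].
- A vertex [z] of [L_s(Y)] and [k] of its neighbours form a tuple of distinct
  points, and a tuple of distinct points of X lies within [r] of it.  Its first
  entry is a shadow of [z]; and if [z] is in X, the tuple also shows that [z] is
  its own shadow, since at most one of its [k + 1] entries is [z]
  ([shadow_exists], [shadow_self]).
- Shadows of adjacent vertices are adjacent in [L_{s+2r}(X)], so shadows of
  connected vertices are connected ([connect_shadow]).
As [x] and [z] are shadows of themselves, they are connected in [L_{s+2r}(X)].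
Thus [[x]_{s+2r}] contains [[x]_t] although [s + 2r < t], so that [(t, [x])] is
not a layer point. *)

(** * Vertices and edges of the degree Rips complex *)

Section RipsGraph.
Set Implicit Arguments.
Unset Strict Implicit.
Variables (R : realType) (Y : finMetricType R) (k : nat) (X : {set Y}).
Implicit Types (s : \bar R) (x y z : Y).

Lemma rips_vertexE s x : (0 <= s)%E ->
  (x \in vertices (degree_rips k X s)) = (x \in X) && (k <= #|neighbours X s x|)%N.
Proof.
move=> s0; rewrite in_vertices !inE finset.sub1set.
have -> : ([set x]%SET != finset.set0) by apply/set0Pn; exists x; rewrite inE.
rewrite /=; case: (x \in X) => //=.
have -> /= : [forall a in [set x]%SET, forall b in [set x]%SET,
                ((mdist a b)%:E <= s)%E].
  by apply/forall_inP => a /set1P ->; apply/forall_inP => b /set1P ->; rewrite mdistxx.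
apply/forall_inP/idP => [|h a /set1P -> //]; by apply; rewrite inE.
Qed.

Lemma rips_edgeE s x y : (0 <= s)%E ->
  edge (degree_rips k X s) x y =
  [&& x \in vertices (degree_rips k X s), y \in vertices (degree_rips k X s)
    & ((mdist x y)%:E <= s)%E].
Proof.
move=> s0; rewrite !rips_vertexE // /edge /= inE.
have -> : ([set x; y]%SET != finset.set0) by apply/set0Pn; exists x; rewrite !inE eqxx.
rewrite finset.subUset !finset.sub1set /=.
apply/idP/idP.
  move=> /and3P[/andP[-> ->] /forall_inP d /forall_inP n] /=.
  rewrite !n ?inE ?eqxx ?orbT //=.
  by move/forall_inP: (d x (set21 _ _)); apply; rewrite !inE eqxx orbT.
move=> /and3P[/andP[-> nx] /andP[-> ny] d] /=.
apply/andP; split; apply/forall_inP => a /set2P[] -> //.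
  by apply/forall_inP => b /set2P[] ->; rewrite ?mdistxx.
by apply/forall_inP => b /set2P[] ->; rewrite ?mdistxx // metric_sym.
Qed.

Lemma in_distinct_tuples (u : k.+1.-tuple Y) :
  reflect (uniq u /\ forall i, tnth u i \in X) (u \in distinct_tuples k X).
Proof.
rewrite inE; apply: (iffP andP) => -[uu]; first by move/all_tnthP.
by move=> h; split=> //; apply/all_tnthP.
Qed.

Lemma vertex_tuple s x : (0 <= s)%E -> x \in vertices (degree_rips k X s) ->
  exists u : k.+1.-tuple Y, [/\ u \in distinct_tuples k X, tnth u ord0 = x
    & forall i, ((mdist x (tnth u i))%:E <= s)%E].
Proof.
move=> s0; rewrite rips_vertexE // => /andP[xX kn].
pose l := take k (enum (neighbours X s x)).
have sz : size (x :: l) == k.+1 by rewrite /= size_take_min -cardE (minn_idPl kn).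
have lN y : y \in l -> y \in neighbours X s x.
  by move=> /mem_take; rewrite mem_enum.
have uN (i : 'I_k.+1) : tnth (Tuple sz) i = x \/ tnth (Tuple sz) i \in neighbours X s x.
  have := mem_tnth i (Tuple sz); rewrite inE => /orP[/eqP|/lN]; by [left|right].
exists (Tuple sz); split=> [||i]; last 2 first.
- by [].
- case: (uN i) => [->|]; first by rewrite mdistxx.
  by rewrite inE => /and3P[].
apply/in_distinct_tuples; split=> [/=|i].
  rewrite take_uniq ?enum_uniq // andbT; apply/negP => /lN.
  by rewrite inE eqxx andbF.
by case: (uN i) => [->//|]; rewrite inE => /andP[].
Qed.

(** The centre [x] may or may not be an entry of the tuple: at most one of the
[k + 1] distinct entries is lost on excluding it. *)
Lemma tuple_vertex s x (u : k.+1.-tuple Y) : (0 <= s)%E -> x \in X ->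
  u \in distinct_tuples k X -> (forall i, ((mdist x (tnth u i))%:E <= s)%E) ->
  x \in vertices (degree_rips k X s).
Proof.
move=> s0 xX /in_distinct_tuples[uu uX] du; rewrite rips_vertexE // xX /=.
have /card_uniqP cu := uu; rewrite size_tuple in cu.
rewrite -ltnS -cu.
apply: (@leq_trans #|x |: neighbours X s x|%SET).
  apply: subset_leq_card; apply/fintype.subsetP => y /tnthP[i ->].
  by rewrite !inE uX du andbT; case: eqP.
by rewrite cardsU1; case: (_ \notin _).
Qed.

End RipsGraph.

(** * Maximal layer points *)

Section LayerPoints.
Set Implicit Arguments.
Unset Strict Implicit.
Variables (R : realType) (Y : finMetricType R) (k : nat) (X : {set Y}).
Implicit Types (s : \bar R) (p q : \bar R * {set Y}).

(** Take the largest distance between points that is at most [s]; the point [x0]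
provides one, namely 0. *)
Lemma rips_floor (x0 : Y) s : (0 <= s)%E -> exists w : Y * Y,
  ((mdist w.1 w.2)%:E <= s)%E /\
  degree_rips k X (mdist w.1 w.2)%:E = degree_rips k X s.
Proof.
move=> s0; pose P (w : Y * Y) := ((mdist w.1 w.2)%:E <= s)%E.
have P0 : P (x0, x0) by rewrite /P mdistxx.
case: (@arg_maxP _ _ _ (x0, x0) P (fun w => (mdist w.1 w.2)%:E) P0) => w Pw wmax.
exists w; split=> //; set s' := (_)%:E.
have le_s (a b : Y) : ((mdist a b)%:E <= s')%E = ((mdist a b)%:E <= s)%E.
  by apply/idP/idP => [/le_trans|]; [apply | apply: (wmax (a, b))].
have En x : neighbours X s' x = neighbours X s x.
  by apply/finset.setP => y; rewrite !inE le_s.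
apply/finset.setP => tau; rewrite !inE; congr [&& _, _, _ & _].
  by do 2 (apply: eq_forallb => ?; congr (_ ==> _)); rewrite le_s.
by apply: eq_forallb => x; rewrite En.
Qed.

(** The least distance at which the set [q.2] is a component is the parameter of
such a layer point. *)
Lemma layer_point_same_set q : in_gamma k X q ->
  exists2 p, layer_point k X p & gamma_le k X p q /\ p.2 = q.2.
Proof.
case: q => t C gq; have /andP[/= t0 CP] := gq; have /imsetP[x0 _ _] := CP.
pose P (w : Y * Y) := ((mdist w.1 w.2)%:E <= t)%E &&
  (C \in pi0 (degree_rips k X (mdist w.1 w.2)%:E)).
have [w0 [w0t Ew0]] := rips_floor x0 t0.
have Pw0 : P w0 by rewrite /P w0t Ew0.
case: (@arg_minP _ _ _ w0 P (fun w => (mdist w.1 w.2)%:E) Pw0) => w /andP[wt wC] wmin.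
have gw : in_gamma k X ((mdist w.1 w.2)%:E, C).
  by rewrite /in_gamma /= lee_fin mdist_ge0.
exists ((mdist w.1 w.2)%:E, C); last by split=> //; apply/gamma_leP.
split=> //; left=> -[v D] gv /(gamma_leP gv gw)[/= vw DC] lt_vw.
rewrite finset.properEneq DC andbT; apply/eqP => E; subst D.
have /andP[/= v0 vC] := gv.
have [w' [w'v Ew']] := rips_floor x0 v0.
have Pw' : P w' by rewrite /P Ew' vC andbT (le_trans w'v) // (le_trans vw).
by have := lt_le_trans lt_vw (wmin _ Pw'); rewrite ltNge w'v.
Qed.

Lemma maximal_layer_point_set p q : in_gamma k X q ->
  maximal_layer_point_below k X p q -> p.2 = q.2.
Proof.
move=> gq [lp pq pmax]; have [p0 lp0 [p0q E0]] := layer_point_same_set gq.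
have [gp gp0] := (proj1 lp, proj1 lp0).
have [_ sub1] := proj1 (gamma_leP gp gq) pq.
have [_ sub2] := proj1 (gamma_leP gp0 gp) (pmax _ lp0 p0q).
by apply/eqP; rewrite finset.eqEsubset sub1 -E0 sub2.
Qed.

End LayerPoints.

(** * Shadows *)

Section Shadows.
Set Implicit Arguments.
Unset Strict Implicit.
Variables (R : realType) (Y : finMetricType R) (k : nat) (X : {set Y}) (r : R).
Hypothesis r_gt0 : 0 < r.
Hypothesis dH_lt : (hausdorff_dist (@tuple_dist R Y k) (distinct_tuples k X)
  (distinct_tuples k [set: Y]) < r%:E)%E.
Implicit Types (s : R) (z a : Y).

Lemma close_tuple (v : k.+1.-tuple Y) : v \in distinct_tuples k [set: Y] ->
  exists2 u, u \in distinct_tuples k X & forall i, mdist (tnth v i) (tnth u i) < r.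
Proof.
move=> vY; move: dH_lt; rewrite /hausdorff_dist gt_max => /andP[_].
move=> /bigmax_ltP[_ /(_ v vY) /bigmin_ltP[//|[u uX]]].
rewrite lte_fin => /bigmax_ltP[_ h]; exists u => // i.
by rewrite metric_sym; exact: h.
Qed.

Definition shadow s z a :=
  (mdist z a < r) && (a \in vertices (degree_rips k X (s + 2 * r)%:E)).

(** The first entry [a] of a tuple of X close to [(z, y_1, ..., y_k)] has the
other entries at distance at most [s + 2r]: the detour goes through [z] and [y_i]. *)
Lemma shadow_exists s z : 0 <= s ->
  z \in vertices (degree_rips k [set: Y] s%:E) -> exists a, shadow s z a.
Proof.
move=> s0 /vertex_tuple[|v [vY v0 dv]]; first by rewrite lee_fin.
have [u uX du] := close_tuple vY; exists (tnth u ord0).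
have d0 : mdist z (tnth u ord0) < r by rewrite -{1}v0.
rewrite /shadow d0 /=; apply: tuple_vertex (uX) _; rewrite ?lee_fin.
- by move: r_gt0 s0; lra.
- by have /in_distinct_tuples[_] := uX.
move=> i; rewrite lee_fin.
have := metric_triangle (tnth u ord0) z (tnth u i).
have := metric_triangle z (tnth v i) (tnth u i).
have := dv i; rewrite lee_fin (metric_sym _ z).
by move: d0 (du i); lra.
Qed.

(** The tuple of X close to [(z, y_1, ..., y_k)] lies within [s + r] of [z]. *)
Lemma shadow_self s z : 0 <= s -> z \in X ->
  z \in vertices (degree_rips k [set: Y] s%:E) -> shadow s z z.
Proof.
move=> s0 zX /vertex_tuple[|v [vY v0 dv]]; first by rewrite lee_fin.
have [u uX du] := close_tuple vY.
rewrite /shadow mdistxx r_gt0 /=; apply: tuple_vertex (uX) _ => //.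
  by rewrite lee_fin; move: r_gt0 s0; lra.
move=> i; rewrite lee_fin.
have := metric_triangle z (tnth v i) (tnth u i).
by have := dv i; rewrite lee_fin; move: r_gt0 (du i); lra.
Qed.

Lemma shadow_edge s z z' a a' : 0 <= s -> mdist z z' <= s ->
  shadow s z a -> shadow s z' a' ->
  edge (degree_rips k X (s + 2 * r)%:E) a a'.
Proof.
move=> s0 dz /andP[da aV] /andP[da' aV']; rewrite rips_edgeE ?aV ?aV' /= ?lee_fin.
  have := metric_triangle a z a'; have := metric_triangle z z' a'.
  by rewrite (metric_sym a z); move: da da' dz; lra.
by move: r_gt0 s0; lra.
Qed.

(** Edge paths are lifted step by step, so that no choice of a shadow for each
vertex has to be made: any two shadows of adjacent, or equal, vertices are
adjacent. *)
Lemma connect_shadow s z z' a a' : 0 <= s ->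
  connect (edge (degree_rips k [set: Y] s%:E)) z z' ->
  shadow s z a -> shadow s z' a' ->
  connect (edge (degree_rips k X (s + 2 * r)%:E)) a a'.
Proof.
move=> s0 /connectP[p]; elim: p z a => [|z1 p IH] z a /=.
  move=> _ -> sa sa'; apply: connect1; apply: shadow_edge sa sa' => //.
  by rewrite mdistxx.
move=> /andP[]; rewrite rips_edgeE ?lee_fin // => /and3P[_ zV dz] pth last_z' sa sa'.
have [a1 sa1] := shadow_exists s0 zV.
apply: connect_trans (IH _ _ pth last_z' sa1 sa').
by apply: connect1; apply: shadow_edge sa sa1.
Qed.

End Shadows.

(** * Comparison of layer points *)

Theorem lemma14 (R : realType) (r : R) (k : nat) (Y : finMetricType R)
    (X : {set Y}) (t s : \bar R) (x y : Y) :
  0 < r ->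
  (hausdorff_dist (@tuple_dist R Y k) (distinct_tuples k X)
     (distinct_tuples k [set: Y]) < r%:E)%E ->
  x \in vertices (degree_rips k X t) ->
  layer_point k X (t, component (degree_rips k X t) x) ->
  (r%:E < t)%E ->
  (t < next_layer_param k X t - (2 * r)%:E)%E ->
  y \in vertices (degree_rips k [set: Y] s) ->
  maximal_layer_point_below k [set: Y]
    (s, component (degree_rips k [set: Y] s) y)
    (t, component (degree_rips k [set: Y] t) x) ->
  (t - (2 * r)%:E <= s)%E /\ (s <= t)%E.
Proof.
move=> r0 dH xV lay _ _ yV maxl.
have [[/andP[/= s0 _] _] [/= st _] _] := maxl; split=> //.
have [a [b Et]] : exists a b : Y, t = (mdist a b)%:E.
  by apply: (@layer_param_dist _ _ k X); exists (component (degree_rips k X t) x).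
have t0 : (0 <= t)%E by rewrite Et lee_fin mdist_ge0.
have XV z : z \in vertices (degree_rips k X t) ->
    z \in X /\ z \in vertices (degree_rips k [set: Y] t).
  rewrite !rips_vertexE // inE /= => /andP[-> kn]; split=> //.
  apply: leq_trans kn _; apply: subset_leq_card; apply/fintype.subsetP => w.
  by rewrite !inE => /and3P[_ -> ->].
have gt : in_gamma k [set: Y] (t, component (degree_rips k [set: Y] t) x).
  by rewrite /in_gamma t0 /=; apply: imset_f; case: (XV x xV).
have /= Eyx := maximal_layer_point_set gt maxl.
rewrite leNgt; apply/negP.
have [s' Es] : exists s' : R, s = s'%:E.
  by move: s0 st; rewrite Et; case: (s) => // s' _ _; exists s'.
subst s; rewrite lee_fin in s0; rewrite {1}Et -EFinB lte_fin => lt_st.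
have {}lt_st : ((s' + 2 * r)%:E < t)%E by rewrite Et lte_fin; move: lt_st; lra.
(* Now [[x]_t] is contained in a component at a parameter smaller than [t]. *)
have sub : component (degree_rips k X t) x \subset
           component (degree_rips k X (s' + 2 * r)%:E) x.
  have key z : z \in component (degree_rips k X t) x ->
      [/\ shadow k X r s' z z & z \in component (degree_rips k [set: Y] s'%:E) y].
    move=> zC; have zyC : z \in component (degree_rips k [set: Y] s'%:E) y.
      rewrite Eyx; move: zC; rewrite !in_componentE => /andP[zV xz].
      rewrite (proj2 (XV _ zV)) /=; apply: connect_sub xz => c d.
      rewrite rips_edgeE // => /and3P[cV dV cd]; apply: connect1.
      by rewrite rips_edgeE // (proj2 (XV _ cV)) (proj2 (XV _ dV)).
    split=> //; apply: shadow_self => //; move: zC zyC; rewrite !in_componentE.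
      by move=> /andP[/XV[]].
    by move=> _ /andP[].
  have [|sx xyC] := key x; first by rewrite in_componentE xV connect0.
  apply/fintype.subsetP => z /key[sz zyC].
  rewrite in_componentE; have /andP[_ ->] := sz.
  apply: connect_shadow sx sz => //.
  by move: zyC; rewrite -(in_component xyC) in_componentE => /andP[].
have xC : x \in component (degree_rips k X (s' + 2 * r)%:E) x.
  by apply: (fintype.subsetP sub); rewrite in_componentE xV connect0.
have gs : in_gamma k X ((s' + 2 * r)%:E, component (degree_rips k X (s' + 2 * r)%:E) x).
  rewrite /in_gamma /= lee_fin; apply/andP; split; first by move: s0 r0; lra.
  by apply: imset_f; move: xC; rewrite in_componentE => /andP[].
have le : gamma_le k X ((s' + 2 * r)%:E, component (degree_rips k X (s' + 2 * r)%:E) x)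
    (t, component (degree_rips k X t) x).
  by split; [exact: ltW | exists x].
case: lay => _ [/(_ _ gs le lt_st)|]; first by rewrite fintype.properE sub andbF.
by apply; eexists; split; [exact: gs | exact: le | exact: lt_st].
Qed.
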